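(* Let $p$ be an odd prime. Then the wreath product $\mathbb{Z}_p \wr \mathbb{Z}_p$ is not GRR-detecting (and is therefore also not DRR-detecting).
   Context: All groups and graphs are finite. $\mathbb{Z}_p$ is the cyclic group of order $p$, and $\mathbb{Z}_p \wr \mathbb{Z}_p = \mathbb{Z}_p \ltimes (\mathbb{Z}_p)^p$, where $\mathbb{Z}_p$ acts on $(\mathbb{Z}_p)^p$ by cyclically permuting the coordinates. For a subset $S$ of a group $G$, the Cayley digraph $\mathrm{Cay}(G,S)$ has vertex set $G$ and a directed edge from $g_1$ to $g_2$ iff $g_2 = s g_1$ for some $s \in S$; if $S$ is inverse-closed it is a graph (Cayley graph). $\mathrm{Aut}(G,S) = \{\varphi \in \mathrm{Aut}(G) : \varphi(S) = S\}$. A digraph $\Gamma$ is a DRR (digraphical regular representation) of $G$ if $\mathrm{Aut}(\Gamma) \cong G$ and acts regularly on the vertices; a GRR is a DRR that is a graph. $G$ is GRR-detecting if for every inverse-closed $S \subseteq G$, $\mathrm{Aut}(G,S)=\{1\}$ implies $\mathrm{Cay}(G,S)$ is a GRR; $G$ is DRR-detecting if for every $S \subseteq G$, $\mathrm{Aut}(G,S)=\{1\}$ implies $\mathrm{Cay}(G,S)$ is a DRR. *)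

(* Defs.v *)
(* MathComp *)
From mathcomp Require Import all_boot all_algebra all_fingroup.

Set Implicit Arguments.
Unset Strict Implicit.
Unset Printing Implicit Defensive.

Import GroupScope GRing.Theory.

(* A digraph on the finite vertex set V is a relation e : rel V (e x y being a
   directed edge from x to y; loops are allowed); it is a graph when e is
   symmetric. *)
Definition digraph_aut (V : finType) (e : rel V) : {set {perm V}} :=
  [set s : {perm V} | [forall x, forall y, e (s x) (s y) == e x y]].

Lemma digraph_aut_group_set (V : finType) (e : rel V) :
  group_set (digraph_aut e).
Proof.
apply/group_setP; split=> [|s t].
  by rewrite inE; apply/'forall_forallP => x y; rewrite !perm1.
rewrite !inE => /'forall_'forall_eqP es /'forall_'forall_eqP et.
by apply/'forall_'forall_eqP => x y; rewrite !permM et es.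
Qed.

Canonical digraph_aut_group (V : finType) (e : rel V) :=
  Group (digraph_aut_group_set e).

Definition acts_regularly (V : finType) (A : {set {perm V}}) : Prop :=
  [transitive A, on [set: V] | 'P] /\ forall x : V, 'C_A[x | 'P] = 1.

Definition is_DRR (gT : finGroupType) (V : finType) (e : rel V) : Prop :=
  digraph_aut e \isog [set: gT] /\ acts_regularly (digraph_aut e).

Definition is_GRR (gT : finGroupType) (V : finType) (e : rel V) : Prop :=
  is_DRR gT e /\ symmetric e.

Definition Cay (gT : finGroupType) (S : {set gT}) : rel gT :=
  fun g1 g2 => [exists s in S, g2 == s * g1].

Definition Aut_fix (gT : finGroupType) (S : {set gT}) : {set {perm gT}} :=
  [set phi in Aut [set: gT] | phi @: S == S].

Definition inverse_closed (gT : finGroupType) (S : {set gT}) : Prop :=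
  forall s, s \in S -> s^-1 \in S.

Definition GRR_detecting (gT : finGroupType) : Prop :=
  forall S : {set gT},
    inverse_closed S -> Aut_fix S = 1 -> is_GRR gT (Cay S).

Definition DRR_detecting (gT : finGroupType) : Prop :=
  forall S : {set gT}, Aut_fix S = 1 -> is_DRR gT (Cay S).

Section Wreath.

Variable p : nat.

(* (Z_p)^p, with coordinates indexed by 'Z_p so that they can be permuted
   cyclically; the type 'Z_p has p elements only when p > 1. *)
Definition Zp_power := {dffun forall _ : 'Z_p, 'Z_p}.

Definition cyclic_shift (f : Zp_power) (a : 'Z_p) : Zp_power :=
  [ffun i : 'Z_p => f (i - a)%R].

Lemma cyclic_shift1 : cyclic_shift^~ 1 =1 id.
Proof. by move=> f; apply/ffunP=> i; rewrite ffunE [1]/(0%R) subr0. Qed.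

Lemma cyclic_shiftM f : act_morph cyclic_shift f.
Proof.
move=> a b; apply/ffunP=> i; rewrite !ffunE.
by rewrite [a * b]/(a + b)%R opprD addrA addrAC.
Qed.

Canonical cyclic_shift_action := TotalAction cyclic_shift1 cyclic_shiftM.

Lemma cyclic_shift_is_groupAction :
  is_groupAction [set: Zp_power] cyclic_shift_action.
Proof.
move=> a _; rewrite inE; apply/andP; split.
  by apply/subsetP=> f; rewrite inE.
apply/morphicP=> f g _ _; rewrite !actpermE /=.
by apply/ffunP=> i; rewrite !ffunE.
Qed.

Canonical cyclic_shift_groupAction := GroupAction cyclic_shift_is_groupAction.

Definition Zp_wreath : finGroupType := sdprod_by cyclic_shift_groupAction.

End Wreath.

(* Main.v *)
(* Write Z_p wr Z_p as the pairs x^k a, with a in A = (Z_p)^p and x the cyclic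
   shift. Let E be the group of sign changes of an even number of coordinates.
   In A ><| (E ><| <x>) the wreath product is regular (on the cosets of E) and
   self-normalising, as E has no nontrivial x-fixed element for p odd. So when
   S is invariant under E the Cayley graph is not regular, the witnesses being
   the maps x^k a |-> x^k (e a), while E itself contributes nothing to
   Aut(G, S). Take for S the union of
     - the vectors +-e_0 and +-e_0 +- e_1 of A,
     - the x t with t in {1,-1}^p of product 1, and the inverses of these,
       the x^-1 t with t in {1,-1}^p of product -1.
   An element of S outside A commutes, within S, only with itself and its
   inverse; hence an automorphism phi preserving S maps e_0 and e_0 + e_1 into
   S :&: A and y := x (1,...,1) outside A. As phi (e_0 + e_1) is the sum of
   phi e_0 and its conjugate under phi y, we get phi y \in x A and
   phi e_0 = +-e_0, so phi = +-1 on A. Applying phi to the translates of y by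
   -2 (e_i + e_(i+1)), which lie in S, forces phi = 1. *)

Require Import Defs.
From mathcomp Require Import all_boot all_algebra all_fingroup.
From mathcomp Require Import ring.

Set Implicit Arguments.
Unset Strict Implicit.
Unset Printing Implicit Defensive.

Import GroupScope GRing.Theory.

(** * Coordinates on the wreath product *)

Section WreathGroup.

Variable p : nat.
Implicit Types (k i : 'Z_p) (f : 'Z_p -> 'Z_p) (g h : Zp_wreath p).

(* [g] is x^(rot g) (crd g) in the notation above. *)
Definition rot g : 'Z_p := (pair_of_sd g).1.
Definition crd g i : 'Z_p := (pair_of_sd g).2 i.

Fact wpair_subproof k (a : Zp_power p) :
  (k, a) \in setX [set: 'Z_p] [set: Zp_power p].
Proof. by rewrite !inE. Qed.

Definition wpair k f : Zp_wreath p :=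
  SdPair (cyclic_shift_groupAction p) (wpair_subproof k [ffun i => f i]).

Lemma rot_wpair k f : rot (wpair k f) = k. Proof. by []. Qed.

Lemma crd_wpair k f : crd (wpair k f) =1 f.
Proof. by move=> i; rewrite /crd ffunE. Qed.

Lemma wreathP g h : rot g = rot h -> crd g =1 crd h -> g = h.
Proof.
rewrite /rot /crd => eq1 eq2; apply: val_inj => /=.
rewrite [LHS]surjective_pairing [RHS]surjective_pairing eq1; congr (_, _).
by apply/ffunP.
Qed.

Lemma rotM g h : rot (g * h) = (rot g + rot h)%R. Proof. by []. Qed.

Lemma crdM g h i : crd (g * h) i = (crd g (i - rot h) + crd h i)%R.
Proof. by rewrite /crd /= !ffunE. Qed.

Lemma rot1 : rot 1 = 0%R. Proof. by []. Qed.

Lemma crd1 i : crd 1 i = 0%R.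
Proof. by rewrite /crd /= ffunE. Qed.

Lemma rotV g : rot g^-1 = (- rot g)%R. Proof. by []. Qed.

Lemma crdV g i : crd g^-1 i = (- crd g (i + rot g))%R.
Proof.
have := crdM g g^-1 (i)%R.
by rewrite mulgV crd1 rotV opprK => /esym/eqP; rewrite addrC addr_eq0 => /eqP.
Qed.

Definition wreathE :=
  (rotM, crdM, rot1, crd1, rotV, crdV, rot_wpair, crd_wpair).

End WreathGroup.

(** * Signs modulo an odd number *)

Section OddModulus.

Variable p : nat.
Hypotheses (p_gt1 : 1 < p) (p_odd : odd p).

Lemma half_Zp : {h : 'Z_p | 2%:R * h = 1}%R.
Proof.
exists (- (p./2)%:R)%R.
have: ((1 + 2 * p./2)%N%:R = 0 :> 'Z_p)%R.
  rewrite -[RHS](pchar_Zp p_gt1); congr (_%:R)%R.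
  by rewrite -[RHS]odd_double_half p_odd mul2n.
by rewrite natrD natrM => /eqP; rewrite addr_eq0 mulrN => /eqP <-.
Qed.

Lemma Zp_two_neq0 : (2%:R != 0 :> 'Z_p)%R.
Proof.
have [h h2] := half_Zp; apply/eqP=> e2; move: h2.
by rewrite e2 mul0r => /esym/eqP; rewrite oner_eq0.
Qed.

Lemma Zp_four_neq0 : (4%:R != 0 :> 'Z_p)%R.
Proof.
have [h h2] := half_Zp; apply/eqP=> e4; move/eqP: Zp_two_neq0; apply.
have -> : (2%:R = 2%:R * (2%:R * h) :> 'Z_p)%R by rewrite h2 mulr1.
by rewrite -[RHS](mul0r h) -e4; ring.
Qed.

Definition is_sign : pred 'Z_p := pred2 1%R (-1)%R.

Lemma is_signP x : reflect (x = 1 \/ x = -1)%R (is_sign x).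
Proof. exact: pred2P. Qed.

Lemma is_signN x : is_sign (- x)%R = is_sign x.
Proof. by rewrite /is_sign /= eqr_oppLR eqr_opp orbC. Qed.

Lemma is_sign1 : is_sign 1%R. Proof. by apply/is_signP; left. Qed.

Lemma is_signM x y : is_sign x -> is_sign y -> is_sign (x * y)%R.
Proof. by move=> /is_signP[]-> sy; rewrite ?mul1r ?mulN1r ?is_signN. Qed.

Lemma sign_neq0 x : is_sign x -> (x != 0)%R.
Proof. by case/is_signP=> ->; rewrite ?oppr_eq0 oner_eq0. Qed.

Lemma sign_neqN x : is_sign x -> (x != - x)%R.
Proof.
have n2 := Zp_two_neq0; rewrite -addr_eq0 => /is_signP[]-> //.
by rewrite -opprD oppr_eq0.
Qed.

(** Here 3 = 1 would give 2 = 0, and 3 = -1 would give 4 = 0. This will exclude a wrong sign in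
    [phi_pivot_crd]. *)
Lemma sign_triple x : is_sign x -> ~~ is_sign (x *+ 3)%R.
Proof.
have sign3 : ~~ is_sign (1 *+ 3)%R.
  apply/is_signP=> -[] /eqP; rewrite -subr_eq0.
    by rewrite mulrS addrAC subrr add0r; apply/negP/Zp_two_neq0.
  by rewrite opprK -mulrSr; apply/negP/Zp_four_neq0.
by case/is_signP=> -> //; rewrite mulNrn is_signN.
Qed.


Lemma Zp_neg1_neq1 : (-1 != 1 :> 'Z_p)%R.
Proof. by rewrite eq_sym; apply/sign_neqN/is_sign1. Qed.

Lemma sign_eq_opp x y : is_sign x -> is_sign y -> x != y -> (x = - y)%R.
Proof. by move=> /is_signP[]-> /is_signP[]->; rewrite ?opprK ?eqxx. Qed.

Lemma signr_Zp : ((-1) ^+ #|'Z_p| = -1 :> 'Z_p)%R.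
Proof.
have odd_card : odd #|'Z_p| by rewrite card_ord Zp_cast.
by rewrite -signr_odd odd_card.
Qed.

(** Both 1 and -1 generate ['Z_p], so invariance under either shift is invariance under all. *)
Lemma shift_const (k : 'Z_p) (f : 'Z_p -> 'Z_p) :
  is_sign k -> (forall i, f i = f (i - k)%R) -> forall i, f i = f 0%R.
Proof.
move=> sk fk.
have f1 i : f (i + 1)%R = f i.
  case/is_signP: sk fk => -> fk; first by rewrite fk addrK.
  by rewrite [in RHS]fk opprK.
move=> i; rewrite -(natr_Zp i); elim: (i : nat) => [|n <-] //.
by rewrite mulrSr f1.
Qed.

(** * The connection set and its closure properties *)

Implicit Types (i k : 'Z_p) (g h : Zp_wreath p).

(* [base] describes the part of the connection set lying in A; [outer] treats
   x A and x^-1 A at once, the product of the signs being the exponent of x. *)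
Definition base g :=
  [&& rot g == 0%R, is_sign (crd g 0%R),
      (crd g 1%R == 0%R) || is_sign (crd g 1%R)
    & [forall i, (i != 0%R) ==> (i != 1%R) ==> (crd g i == 0%R)]].

Definition outer g :=
  [&& is_sign (rot g), [forall i, is_sign (crd g i)]
    & (\prod_i crd g i)%R == rot g].

Definition conn : {set Zp_wreath p} := [set g | base g || outer g].

Lemma baseP g :
  reflect [/\ rot g = 0%R, is_sign (crd g 0%R),
             crd g 1%R = 0%R \/ is_sign (crd g 1%R)
           & forall i, i != 0%R -> i != 1%R -> crd g i = 0%R]
          (base g).
Proof.
apply: (iffP and4P) => [[/eqP r0 s0 s1 /'forall_implyP s2]|[-> s0 s1 s2]].
  split=> // [|i i0 i1]; first by case/orP: s1 => [/eqP|]; [left | right].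
  by have /implyP/(_ i1)/eqP := s2 i i0.
split=> //; first by case: s1 => [->|->]; rewrite ?eqxx ?orbT.
by apply/forallP=> i; apply/implyP=> i0; apply/implyP=> i1; apply/eqP/s2.
Qed.

Lemma outerP g :
  reflect [/\ is_sign (rot g), forall i, is_sign (crd g i)
           & (\prod_i crd g i)%R = rot g]
          (outer g).
Proof.
by apply: (iffP and3P) => [] [sr /forallP sc /eqP pr]; split=> //; apply/eqP.
Qed.

Lemma prodN_Zp (f : 'Z_p -> 'Z_p) :
  (\prod_i - f i = - \prod_i f i)%R.
Proof. by rewrite prodrN signr_Zp mulN1r. Qed.

Lemma baseV g : base g -> base g^-1.
Proof.
case/baseP=> r0 s0 s1 s2; apply/baseP.
split=> [|||i i0 i1]; rewrite !wreathE r0 ?oppr0 ?addr0 ?is_signN //.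
  by case: s1 => [->|s1]; [left; rewrite oppr0 | right].
by rewrite s2 ?oppr0.
Qed.

(** Inversion negates an odd number of coordinates, hence their product, in step with the exponent
    of x. *)
Lemma outerV g : outer g -> outer g^-1.
Proof.
case/outerP=> sr sc pr; apply/outerP; split=> [|i|].
- by rewrite rotV is_signN.
- by rewrite crdV is_signN.
rewrite rotV -pr -prodN_Zp [RHS](reindex_inj (addIr (rot g))).
by apply: eq_bigr => i _; rewrite crdV.
Qed.

Lemma conn_inverse_closed : inverse_closed conn.
Proof.
by move=> g; rewrite !inE => /orP[/baseV|/outerV] ->; rewrite ?orbT.
Qed.

Lemma conn_scale g h (c : 'Z_p -> 'Z_p) :
    (forall i, is_sign (c i)) -> (\prod_i c i = 1)%R ->
    rot h = rot g -> (forall i, crd h i = crd g i * c i)%R ->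
  g \in conn -> h \in conn.
Proof.
move=> sc pc rh ch; rewrite !inE => /orP[/baseP[r0 s0 s1 s2]|/outerP[sr sg pr]].
  apply/orP; left; apply/baseP; rewrite rh !ch.
  split=> // [||i i0 i1]; first exact: is_signM.
    by case: s1 => [->|s1]; [left; rewrite mul0r | right; apply: is_signM].
  by rewrite ch s2 ?mul0r.
apply/orP; right; apply/outerP; rewrite rh; split=> // [i|].
  by rewrite ch is_signM.
by rewrite (eq_bigr _ (fun i _ => ch i)) big_split /= pc mulr1.
Qed.

(** * A nontrivial graph automorphism fixing the identity *)

Definition flip i0 i : 'Z_p := if pred2 i0 (i0 + 1)%R i then (-1)%R else 1%R.

Lemma is_sign_flip i0 i : is_sign (flip i0 i).
Proof. by rewrite /flip; case: ifP; rewrite ?is_signN is_sign1. Qed.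

Lemma prod_flip i0 : (\prod_i flip i0 i = 1)%R.
Proof.
have n01 : (i0 + 1 != i0)%R by rewrite -subr_eq0 addrC addKr oner_eq0.
rewrite (bigD1 i0) //= (bigD1 (i0 + 1)%R) //= big1 ?mulr1 => [|i /andP[i0' i1]].
  by rewrite /flip /= !eqxx orbT mulrNN mulr1.
by rewrite /flip /= (negPf i0') (negPf i1).
Qed.

Definition twist g := wpair (rot g) (fun i => crd g i * flip 0 i)%R.

Lemma twistK : involutive twist.
Proof.
move=> g; apply: wreathP => [|i]; rewrite !wreathE //.
by rewrite -mulrA; case/is_signP: (is_sign_flip 0%R i) => ->;
  rewrite ?mulrNN !mulr1.
Qed.

(** Coordinate i of h g^-1 is a difference of coordinates at [i + rot g], so twisting both elements
    rescales it by a shifted [flip], still of product 1. *)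
Lemma mem_conn_twist g h :
  h * g^-1 \in conn -> twist h * (twist g)^-1 \in conn.
Proof.
apply: (conn_scale (c := fun i => flip 0%R (i + rot g)%R)) => [i||//|i].
- exact: is_sign_flip.
- by rewrite -[RHS](prod_flip 0%R) [RHS](reindex_inj (addIr (rot g))).
by rewrite !wreathE opprK mulrBl.
Qed.

Lemma CayE g h : Cay conn g h = (h * g^-1 \in conn).
Proof.
apply/exists_inP/idP=> [[s sS /eqP->]|sS]; first by rewrite mulgK.
by exists (h * g^-1); rewrite ?mulgKV.
Qed.

Definition twist_perm := perm (inv_inj twistK).

Lemma Cay_not_regular : ~ acts_regularly (digraph_aut (Cay conn)).
Proof.
case=> _ /(_ 1) regular1.
have : twist_perm \in 'C_(digraph_aut (Cay conn))[1 | 'P].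
  rewrite inE; apply/andP; split.
    rewrite inE; apply/'forall_'forall_eqP=> g h.
    rewrite !CayE !permE; apply/idP/idP; last exact: mem_conn_twist.
    by move/mem_conn_twist; rewrite !twistK.
  apply/astab1P; rewrite /= apermE permE.
  by apply: wreathP => [|i]; rewrite !wreathE // mul0r.
(* The twist negates coordinate 0 of this element, so it is not the identity. *)
rewrite regular1 inE => /eqP/permP/(_ (wpair 0%R (fun=> 1%R))).
rewrite permE perm1 => /(congr1 (fun g => crd g 0%R)).
rewrite !wreathE mul1r => /eqP.
exact/negP/Zp_neg1_neq1.
Qed.

(** * Commuting elements of the connection set *)

Lemma commute_crd g h i :
  commute g h -> (crd g (i - rot h) + crd h i = crd h (i - rot g) + crd g i)%R.
Proof. by move=> cgh; rewrite -!crdM cgh. Qed.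

(** Commuting makes [crd g - crd h] shift-invariant, hence constant. As all coordinates are signs,
    either g and h agree or they are opposite everywhere; the latter negates the product, p being
    odd, although the exponents are equal. *)
Lemma outer_commute_same_rot g h :
  outer g -> outer h -> rot h = rot g -> commute g h -> h = g.
Proof.
move=> /outerP[sr sg pg] /outerP[_ sh ph] rgh cgh.
have dcst i : (crd g i - crd h i = crd g 0 - crd h 0)%R.
  apply: (@shift_const (rot g) (fun i => crd g i - crd h i)%R) => // k.
  have := commute_crd k cgh; rewrite rgh => e.
  apply: (addIr (crd h (k - rot g) + crd h k)%R).
  transitivity (crd h (k - rot g) + crd g k)%R; first by ring.
  by rewrite -e; ring.
have [e0|n0] := eqVneq (crd h 0%R) (crd g 0%R).
  apply: wreathP => // i; apply/esym/eqP; rewrite -subr_eq0 dcst e0.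
  by rewrite subrr.
have opp i : (crd h i = - crd g i)%R.
  apply: sign_eq_opp => //; apply: contra n0 => /eqP e.
  by rewrite eq_sym -subr_eq0 -(dcst i) e subrr.
have := sign_neqN sr; rewrite -{1}rgh -ph (eq_bigr _ (fun i _ => opp i)).
by rewrite prodN_Zp pg eqxx.
Qed.

Lemma Zp_add11_neq : (1 + 1 != 0 :> 'Z_p)%R /\ (1 + 1 != 1 :> 'Z_p)%R.
Proof.
by split; rewrite ?Zp_two_neq0 // -subr_eq0 addrK oner_eq0.
Qed.

Lemma outer_commute g h :
  outer g -> h \in conn -> commute g h -> h = g \/ h = g^-1.
Proof.
move=> og; rewrite inE => /orP[/baseP[r0 s0 _ s2] cgh|oh cgh].
  have /outerP[sr _ _] := og.
  (* An element of A commuting with g has constant coordinates, but a base element is nonzero at 0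
     and zero at 2. *)
  have hcst := @shift_const (rot g) (crd h) sr.
  have /eqP[] := sign_neq0 s0; rewrite -(hcst _ (1 + 1)%R) => [|i].
    by have [n0 n1] := Zp_add11_neq; rewrite s2.
  by have := commute_crd i cgh; rewrite r0 subr0 addrC => /addIr.
have /outerP[sg _ _] := og; have /outerP[sh _ _] := oh.
have [e|n] := eqVneq (rot h) (rot g).
  by left; apply: outer_commute_same_rot.
right; apply: invg_inj; rewrite invgK; apply: outer_commute_same_rot => //.
- exact: outerV.
- by rewrite rotV (sign_eq_opp sh sg n) opprK.
exact: commuteV.
Qed.

(** * Conjugation, and the test elements of the connection set *)

Lemma crdJ g h i : rot g = 0%R -> crd (g ^ h) i = crd g (i - rot h)%R.
Proof.
by move=> r0; rewrite /conjg !wreathE r0 add0r subrK addrCA addNr addr0.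
Qed.

Lemma rotJ g h : rot (g ^ h) = rot g.
Proof. by rewrite /conjg !wreathE addrC addrK. Qed.

Lemma rot0_commute g h : rot g = 0%R -> rot h = 0%R -> commute g h.
Proof.
move=> rg rh; apply: wreathP => [|i]; rewrite !wreathE rg rh //.
by rewrite subr0 addrC.
Qed.

Definition axis i0 : Zp_wreath p := wpair 0%R (fun i => (i == i0)%:R)%R.

Definition edge := axis 0%R * axis 1%R.

Definition pivot : Zp_wreath p := wpair 1%R (fun=> 1)%R.

Lemma axisJ i0 : axis i0 ^ pivot = axis (i0 + 1)%R.
Proof.
apply: wreathP => [|i]; first by rewrite rotJ.
by rewrite crdJ // !wreathE subr_eq.
Qed.

Lemma crd_edge i : crd edge i = ((i == 0)%:R + (i == 1)%:R)%R.
Proof. by rewrite !wreathE subr0. Qed.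

Lemma base_axis0 : base (axis 0%R).
Proof.
apply/baseP; split=> [|||i /negPf i0 _]; rewrite wreathE //.
  by left; rewrite oner_eq0.
by rewrite i0.
Qed.

Lemma base_edge : base edge.
Proof.
apply/baseP; split=> [|||i /negPf i0 /negPf i1]; rewrite ?crd_edge.
- by rewrite !wreathE addr0.
- by rewrite eqxx eq_sym oner_eq0 addr0 is_sign1.
- by right; rewrite oner_eq0 eqxx add0r is_sign1.
by rewrite i0 i1 addr0.
Qed.

Lemma outer_pivot : outer pivot.
Proof.
apply/outerP; split=> [|i|]; rewrite ?wreathE ?is_sign1 //.
by rewrite big1 // => i _; rewrite wreathE.
Qed.

Lemma edge_neq_axis0 : edge <> axis 0%R /\ edge <> (axis 0%R)^-1.
Proof.
split=> /(congr1 (fun g => crd g 1%R)); rewrite crd_edge !wreathE ?addr0;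
  rewrite eqxx oner_eq0 add0r ?oppr0 => /eqP; exact/negP/oner_neq0.
Qed.

Definition tilt i0 := pivot * (axis i0 * axis (i0 + 1)%R) ^- 2.

Lemma axis_pair_crd i0 i : crd (axis i0 * axis (i0 + 1)%R) i =
  ((i == i0)%:R + (i == i0 + 1)%:R)%R.
Proof. by rewrite !wreathE subr0. Qed.

(** Subtracting 2 turns two of the coordinates 1 of [pivot] into -1, which keeps the product 1. *)
Lemma outer_tilt i0 : outer (tilt i0).
Proof.
have ct i : crd (tilt i0) i = flip i0 i.
  rewrite /tilt expg2 crdM crdV crdM rotV !rotM /= !rot_wpair.
  rewrite !(addr0, subr0, oppr0) !axis_pair_crd crd_wpair /flip /=.
  have n01 : (i0 + 1 != i0)%R by rewrite -subr_eq0 addrC addKr oner_eq0.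
  have [->|_] := eqVneq i i0; first by rewrite eq_sym (negPf n01) /=; ring.
  by case: eqVneq => _ /=; ring.
apply/outerP; split=> [|i|].
- by rewrite /tilt expg2 !wreathE !(addr0, subr0, oppr0) is_sign1.
- by rewrite ct is_sign_flip.
rewrite (eq_bigr _ (fun i _ => ct i)) prod_flip.
by rewrite /tilt expg2 !wreathE !(addr0, subr0, oppr0).
Qed.

Lemma rot_pivotX n : rot (pivot ^+ n) = (n%:R)%R.
Proof. by elim: n => // n IHn; rewrite expgS rotM IHn mulrS. Qed.

Lemma axisX i0 n : axis i0 ^+ n = wpair 0%R (fun i => (i == i0)%:R *+ n)%R.
Proof.
elim: n => [|n IHn]; first by apply: wreathP => [|i]; rewrite !wreathE.
rewrite expgS IHn; apply: wreathP => [|i]; rewrite !wreathE ?addr0 //.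
by rewrite subr0 mulrS.
Qed.

Lemma rot0_prod g :
  rot g = 0%R -> g = \prod_i axis i ^+ (crd g i : nat).
Proof.
move=> r0.
have prodE (s : seq 'Z_p) : \prod_(i <- s) axis i ^+ (crd g i : nat)
    = wpair 0%R (fun k => \sum_(i <- s) (k == i)%:R * crd g i)%R.
  elim: s => [|i s IHs].
    by apply: wreathP => [|k]; rewrite big_nil !wreathE ?big_nil.
  rewrite big_cons IHs axisX.
  apply: wreathP => [|k]; rewrite !wreathE ?addr0 //.
  by rewrite big_cons subr0 -mulr_natr natr_Zp.
rewrite prodE; apply: wreathP => [|k]; rewrite !wreathE //.
rewrite (bigD1 k) //= eqxx mul1r big1 ?addr0 // => i /negPf ik.
by rewrite eq_sym ik mul0r.
Qed.

(** * Automorphisms preserving the connection set *)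

Section Automorphism.

Variable phi : {morphism [set: Zp_wreath p] >-> Zp_wreath p}.
Hypotheses (phi_inj : injective phi)
           (phi_conn : forall g, g \in conn -> phi g \in conn).

Let phiM g h : phi (g * h) = phi g * phi h.
Proof. by rewrite morphM ?inE. Qed.
Let phiV g : phi g^-1 = (phi g)^-1.
Proof. by rewrite morphV ?inE. Qed.
Let phiX g n : phi (g ^+ n) = phi g ^+ n.
Proof. by rewrite morphX ?inE. Qed.
Let phiJ g h : phi (g ^ h) = phi g ^ phi h.
Proof. by rewrite morphJ ?inE. Qed.

(** If [phi g] were outer, then [phi h], which commutes with it, would be [phi g] or its inverse,
    against injectivity. *)
Lemma phi_base g h :
  base g -> base h -> h <> g -> h <> g^-1 -> base (phi g).
Proof.
move=> bg bh ng nV.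
have := phi_conn (g := g); rewrite inE bg => /(_ isT).
rewrite inE => /orP[] // og.
have hc : phi h \in conn by rewrite phi_conn // inE bh.
have cgh : commute (phi g) (phi h).
  have /baseP[rg _ _ _] := bg; have /baseP[rh _ _ _] := bh.
  by rewrite /commute -!phiM (rot0_commute rg rh).
by case: (outer_commute og hc cgh); rewrite -?phiV => /phi_inj.
Qed.

Lemma phi_base_axis0 : base (phi (axis 0%R)).
Proof.
by have [n nV] := edge_neq_axis0; apply: phi_base base_edge _ _;
  rewrite ?base_axis0.
Qed.

Lemma phi_base_edge : base (phi edge).
Proof.
have [n nV] := edge_neq_axis0.
apply: phi_base base_edge base_axis0 _ _; first exact: nesym.
by move=> e; apply: nV; rewrite e invgK.
Qed.

(** Otherwise [phi pivot] and [phi (axis 0)] both lie in A and commute, so [pivot] commutes with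
    [axis 0], against [outer_commute]. *)
Lemma phi_outer_pivot : outer (phi pivot).
Proof.
have := phi_conn (g := pivot); rewrite inE outer_pivot orbT => /(_ isT).
rewrite inE => /orP[/baseP[r0 _ _ _]|//].
have /baseP[r0' _ _ _] := phi_base_axis0.
have c : commute pivot (axis 0%R).
  by apply: phi_inj; rewrite !phiM (rot0_commute r0 r0').
have a0 : axis 0%R \in conn by rewrite inE base_axis0.
by case: (outer_commute outer_pivot a0 c) => /(congr1 (@rot p)) /eqP;
  rewrite !wreathE eq_sym ?oppr_eq0 oner_eq0.
Qed.

Lemma phi_axis0 :
  rot (phi pivot) = 1%R /\
  forall i, i != 0%R -> crd (phi (axis 0%R)) i = 0%R.
Proof.
have /baseP[r0 s0 s1 s2] := phi_base_axis0.
have /baseP[_ _ _ e2] := phi_base_edge.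
have eE i : (crd (phi edge) i = crd (phi (axis 0)) i
                              + crd (phi (axis 0)) (i - rot (phi pivot)))%R.
  rewrite /edge; have <- : axis 0%R ^ pivot = axis 1%R by rewrite axisJ add0r.
  rewrite phiM phiJ crdM rotJ r0 subr0.
  by rewrite (crdJ _ _ r0).
(* If [phi pivot] had exponent -1, then [eE] at -1 would make coordinate 0 of [phi (axis 0)] vanish.
   With exponent 1, [eE] at 2 kills coordinate 1. *)
have /outerP[/is_signP[] rv _ _] := phi_outer_pivot; last first.
  have n0 : (-1 != 0 :> 'Z_p)%R by rewrite oppr_eq0 oner_eq0.
  have := eE (-1)%R; rewrite rv opprK addNr s2 // ?e2 ?Zp_neg1_neq1 // add0r.
  by move=> e; have := sign_neq0 s0; rewrite -e eqxx.
split=> // i i0; have [->|] := eqVneq i 1%R; last exact: s2.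
have [n0 n1] := Zp_add11_neq.
by have := eE (1 + 1)%R; rewrite rv addrK e2 // s2 // add0r.
Qed.

(** Conjugation by [pivot] moves each axis to the next, and [phi pivot] also shifts by 1, so one
    sign serves all axes. *)
Lemma phi_axis i0 k :
  rot (phi (axis i0)) = 0%R /\
  crd (phi (axis i0)) k = (crd (phi (axis 0)) 0 * (k == i0)%:R)%R.
Proof.
have [rv a0] := phi_axis0; have /baseP[r0 _ _ _] := phi_base_axis0.
rewrite -(natr_Zp i0); elim: (i0 : nat) k => [|n IHn] k.
  split=> //; have [->|k0] := eqVneq k 0%R; first by rewrite mulr1.
  by rewrite (a0 k k0) mulr0n mulr0.
have [rn _] := IHn 0%R.
rewrite mulrSr -axisJ phiJ rotJ; split=> //.
have [_ cn] := IHn (k - 1)%R.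
by rewrite (crdJ _ _ rn) rv cn subr_eq.
Qed.

(** Let s be the common sign on the axes. Coordinate i of [phi (tilt i)] is that of [phi pivot]
    minus 2s; starting from -s it would be -3s, which is not a sign. *)
Lemma phi_pivot_crd i : crd (phi pivot) i = crd (phi (axis 0%R)) 0%R.
Proof.
have [rv a0] := phi_axis0; have /baseP[r0 s0 _ _] := phi_base_axis0.
have /outerP[_ sv _] := phi_outer_pivot.
have := phi_conn (g := tilt i); rewrite inE outer_tilt orbT => /(_ isT).
have rt : rot (phi (tilt i)) = 1%R.
  have [ri _] := phi_axis i 0%R; have [ri1 _] := phi_axis (i + 1)%R 0%R.
  rewrite /tilt expg2 phiM phiV !phiM !wreathE ri ri1 rv.
  by rewrite !(addr0, subr0, oppr0).
rewrite inE => /orP[/baseP[/eqP]|/outerP[_ /(_ i)]].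
  by rewrite rt oner_eq0.
have [ri ci] := phi_axis i i; have [ri1 ci1] := phi_axis (i + 1)%R i.
rewrite /tilt expg2 phiM phiV !phiM !wreathE ri ri1.
rewrite !(addr0, subr0, oppr0) ci ci1 eqxx.
have n01 : (i != i + 1)%R by rewrite eq_sym -subr_eq0 addrC addKr oner_eq0.
rewrite (negPf n01) mulr0 mulr1 !addr0.
have [//|n] := eqVneq (crd (phi pivot) i) (crd (phi (axis 0%R)) 0%R).
rewrite (sign_eq_opp (sv i) s0 n) -opprD is_signN addrA => s3.
by have := sign_triple s0; rewrite !mulrSr mulr0n add0r s3.
Qed.

(** The coordinates of [phi pivot] multiply to s^p = s, which must equal its exponent 1. *)
Lemma phi_axis_crd0 : crd (phi (axis 0%R)) 0%R = 1%R.
Proof.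
have [rv _] := phi_axis0; have /baseP[_ s0 _ _] := phi_base_axis0.
have /outerP[_ _] := phi_outer_pivot.
rewrite rv (eq_bigr _ (fun i _ => phi_pivot_crd i)) prodr_const.
by case/is_signP: s0 => -> //; rewrite signr_Zp.
Qed.

Lemma phi_fix_pivot : phi pivot = pivot.
Proof.
have [rv _] := phi_axis0.
by apply: wreathP => // i; rewrite phi_pivot_crd phi_axis_crd0 !wreathE.
Qed.

Lemma phi_fix_axis i0 : phi (axis i0) = axis i0.
Proof.
apply: wreathP => [|k]; first by have [] := phi_axis i0 0%R.
by have [_ ->] := phi_axis i0 k; rewrite phi_axis_crd0 mul1r wreathE.
Qed.

Lemma phi_id g : phi g = g.
Proof.
have fix0 h : rot h = 0%R -> phi h = h.
  move=> /rot0_prod ->; apply: (big_ind (fun g => phi g = g)).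
  - exact: morph1 phi.
  - by move=> a b ea eb; rewrite phiM ea eb.
  by move=> i _; rewrite phiX phi_fix_axis.
(* Splitting off a power of [pivot] leaves an element of A, a product of powers of axes. *)
rewrite -(mulKVg (pivot ^+ (rot g : nat)) g) phiM phiX phi_fix_pivot fix0 //.
by rewrite rotM rotV rot_pivotX natr_Zp addNr.
Qed.

End Automorphism.

Lemma Aut_fix_conn : Aut_fix conn = 1.
Proof.
apply/setP=> phi; rewrite in_set1.
apply/setIdP/eqP=> [[Aphi /eqP phiS]|->]; last first.
  split; first exact: group1.
  by rewrite (eq_imset _ (perm1 (T := Zp_wreath p))) imset_id.
apply/permP=> g; rewrite perm1 -(autmE Aphi).
apply: phi_id => [h k|h hS]; rewrite ?autmE; first exact: perm_inj.
by rewrite -phiS imset_f.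
Qed.

End OddModulus.

Theorem theorem1p6 (p : nat) (p_prime : prime p) (p_odd : odd p) :
  ~ GRR_detecting (Zp_wreath p) /\ ~ DRR_detecting (Zp_wreath p).
Proof.
have p_gt1 := prime_gt1 p_prime; have Afix := Aut_fix_conn p_gt1 p_odd.
split=> detect; apply: (Cay_not_regular p_gt1 p_odd).
  by have [[]] := detect _ (conn_inverse_closed p_gt1 p_odd) Afix.
by have [] := detect _ Afix.
Qed.
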